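(* Let $k\geq 2$ be an integer and let $c_{k}=\sqrt{k(k-1)(k+2\sqrt{2k}+2)}$. Let $n_{0}(k)$ be the smallest positive integer such that $n-4c_{k}\sqrt{n}-2k^{2}-4k-4\geq 0$ for every integer $n\geq n_{0}(k)$. Let $G$ be a connected graph of order $n\geq n_{0}(k)$ with $\sigma_{2}(G)\geq n-2$. Then $G$ has a $[2,k]$-ST if and only if $G$ is not isomorphic to any graph in $\mathcal{G}_{k,n}$.
   Context: All graphs are finite and simple. For a graph $G$ and $u\in V(G)$, $N_G(u)$ is the neighborhood and $d_G(u)=|N_G(u)|$. If $G$ is not complete, $\sigma_{2}(G)=\min\{d_{G}(u)+d_{G}(v): u,v\in V(G),\ u\neq v,\ uv\notin E(G)\}$; if $G$ is complete, $\sigma_2(G)=\infty$. A $[2,k]$-ST of $G$ is a spanning tree $T$ of $G$ having no vertex whose degree in $T$ lies in $\{2,3,\dots,k\}$. For integers $k\geq 2$ and $n\geq 2k+1$, $\mathcal{G}_{k,n}$ is the family of graphs $G$ of order $n$ such that: (L1) $V(G)$ is the disjoint union of four non-empty sets $L_1,L_2,L_3,L_4$; (L2) $L_1\cup L_2$ and $L_4$ are cliques of $G$; (L3) every $u_1\in L_1$ has no neighbor in $L_3\cup L_4$; (L4) every $u_2\in L_2$ has a neighbor in $L_3$, no neighbor in $L_4$, and $d_G(u_2)\leq k$; (L5) every $u_3\in L_3$ has a neighbor in $L_2$, is adjacent to all vertices of $L_4$, and satisfies $d_G(u_3)\geq n-|L_1\cup L_2|-1$. *)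

(* Defs.v *)
From mathcomp Require Import all_boot all_order all_algebra.
From mathcomp Require Import reals constructive_ereal.
From mathcomp Require Import lra.

Set Implicit Arguments.
Unset Strict Implicit.
Unset Printing Implicit Defensive.

Import Order.TTheory GRing.Theory Num.Theory.

Record sgraph := SGraph {
  vertex :> finType;
  adj : rel vertex;
  adj_sym : symmetric adj;
  adj_irrefl : irreflexive adj }.

Arguments adj {s}.

Definition nbhd (G : sgraph) (u : G) : {set G} := [set v | adj u v].

Definition deg (G : sgraph) (u : G) : nat := #|nbhd u|.

Definition clique (G : sgraph) (S : {set G}) : Prop :=
  {in S &, forall u v, u != v -> adj u v}.

Definition connected (G : sgraph) : Prop := forall u v : G, connect adj u v.

(* A cycle of a simple graph is listed by a duplicate-free sequence of at least
   three vertices; [path.cycle] alone also accepts sequences of size 0 and 2. *)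
Definition acyclic (G : sgraph) : Prop :=
  forall c : seq G, 2 < size c -> uniq c -> ~~ cycle adj c.

Definition is_tree (G : sgraph) : Prop := connected G /\ acyclic G.

Definition isomorphic (G H : sgraph) : Prop :=
  exists2 f : G -> H, bijective f & forall u v, adj (f u) (f v) = adj u v.

(* The minimum over the empty set of pairs (complete graph) is +oo. *)
Definition sigma2 (G : sgraph) : \bar int :=
  \big[Order.min/+oo%E]_(p : G * G | (p.1 != p.2) && ~~ adj p.1 p.2)
     ((deg p.1 + deg p.2)%N%:Z)%:E.

(* The spanning tree is the graph on the vertices of G with edge relation t. *)
Definition has_2k_ST (k : nat) (G : sgraph) : Prop :=
  exists (t : rel G) (ts : symmetric t) (ti : irreflexive t),
    let T := SGraph ts ti in
    [/\ subrel t (@adj G), is_tree T & forall v : T, ~~ (2 <= deg v <= k)].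

Definition Gkn (k n : nat) (G : sgraph) : Prop :=
  #|G| = n /\
  exists L1 L2 L3 L4 : {set G},
    [/\ [/\ L1 :|: L2 :|: L3 :|: L4 = [set: G],
            [&& [disjoint L1 & L2], [disjoint L1 & L3], [disjoint L1 & L4],
                [disjoint L2 & L3], [disjoint L2 & L4] & [disjoint L3 & L4]]
          & [&& L1 != set0, L2 != set0, L3 != set0 & L4 != set0]],
        clique (L1 :|: L2) /\ clique L4,
        {in L1, forall u, forall v, v \in L3 :|: L4 -> ~~ adj u v},
        {in L2, forall u, [/\ exists2 v, v \in L3 & adj u v,
                              forall v, v \in L4 -> ~~ adj u v
                            & deg u <= k]}
      & {in L3, forall u, [/\ exists2 v, v \in L2 & adj u v,
                              forall v, v \in L4 -> adj u v
                            & n - #|L1 :|: L2| - 1 <= deg u]}].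

Local Open Scope ring_scope.

Definition ck (R : realType) (k : nat) : R :=
  Num.sqrt (k%:R * (k%:R - 1) * (k%:R + 2 * Num.sqrt (2 * k%:R) + 2)).

Definition n0_bound (R : realType) (k m : nat) : Prop :=
  forall n : nat, (m <= n)%N ->
    0 <= n%:R - 4 * ck R k * Num.sqrt n%:R - 2 * k%:R ^+ 2 - 4 * k%:R - 4 :> R.

Definition is_n0 (R : realType) (k m : nat) : Prop :=
  [/\ (0 < m)%N, n0_bound R k m
    & forall m' : nat, (0 < m')%N -> n0_bound R k m' -> (m <= m')%N].

Lemma is_n0_exists (R : realType) (k : nat) : exists m, is_n0 R k m.
Proof.
have [N] : exists N : nat, (0 < N)%N /\ n0_bound R k N.
  set b : R := 2 * k%:R ^+ 2 + 4 * k%:R + 4.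
  have b0 : 0 <= b by rewrite /b; have := ler0n R k; nra.
  have c0 : 0 <= ck R k by exact: sqrtr_ge0.
  set s0 := 4 * ck R k + b + 1.
  have s00 : 0 <= s0 by rewrite /s0; lra.
  exists (Num.bound (s0 ^+ 2)).+1; split=> // n leNn.
  have lt_n : s0 ^+ 2 <= n%:R.
    apply: ltW; apply: lt_le_trans (archi_boundP (exprn_ge0 2 s00)) _.
    by rewrite ler_nat ltnW.
  have les : s0 <= Num.sqrt n%:R by rewrite -(ger0_norm s00) -sqrtr_sqr ler_wsqrtr.
  have := sqr_sqrtr (ler0n R n); set s := Num.sqrt _ in les * => <-.
  have : 0 <= (s - s0) * s + (b + 1) * (s - 1) + 1.
    have s1 : 1 <= s by apply: le_trans les; rewrite /s0; lra.
    by apply: addr_ge0 => //; apply: addr_ge0; apply: mulr_ge0; lra.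
  rewrite /s0 -/b; rewrite /b; lra.
elim/ltn_ind: N => N IH [N0 PN].
have [[m []]|noM] := classical.boolp.pselect
   (exists m, (m < N)%N /\ ((0 < m)%N /\ n0_bound R k m)).
  exact: IH.
exists N; split=> // m m0 Pm; rewrite leqNgt; apply/negP => mN.
by apply: noM; exists m.
Qed.

(* Main.v *)
Require Import Defs.
From mathcomp Require Import all_boot all_order all_algebra.
From mathcomp Require Import reals constructive_ereal.
From mathcomp Require Import zify lra.

Set Implicit Arguments.
Unset Strict Implicit.
Unset Printing Implicit Defensive.

Import Order.TTheory GRing.Theory Num.Theory.

(** Both sides are governed by one local obstruction: a vertex of degree at most
    [k] all of whose neighbours have degree at most [k].  In a [2,k]-ST such a
    vertex and its neighbours would all be leaves, and the Ore condition turns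
    the obstruction into the structure [Gkn].

    Without the obstruction, it suffices to find a small connected dominating
    set [C] of centers whose degrees are large compared with [k * #|C|]: the
    centers then greedily pick disjoint sets of [k] leaves.  A single center of
    small degree can be afforded by fixing its leaves first.  Let [u] have
    minimum degree [d].  Vertices of degree below [n/2 - 1] form a clique, so one
    of them dominates all the others, and the remaining vertices are dominated
    by logarithmically many centers by averaging.
    - If [d] is at least about [n/3], every vertex can be a center, and since
      [G] has diameter at most 3, the centers are connected at little cost.
    - Otherwise all vertices outside [N[u]] have degree at least [n - 2 - d], and
      the centers are taken there, except one hub in [N[u]], which dominates the
      vertices of low degree. *)

(** * Arithmetic *)

(** Bernoulli's inequality [(1 + 1/b)^j >= 1 + j/b] with denominators cleared. *)
Lemma bernoulli_expn (b j : nat) : 0 < b -> b ^ j * (b + j) <= b.+1 ^ j * b.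
Proof.
move=> b0; elim: j => [|j IH]; first by rewrite !expn0 addn0.
rewrite !expnS -!mulnA; apply: leq_trans (_ : b.+1 * (b ^ j * (b + j)) <= _).
  by rewrite mulnCA [b.+1 * _]mulnCA leq_mul2l; apply/orP; right; nia.
by rewrite leq_mul2l IH orbT.
Qed.

(** Minimality gives the reverse inequality at [i], which keeps the exponent logarithmic in [n]. *)
Lemma exists_min_exponent (b n : nat) : 0 < b -> 0 < n ->
  exists i, n * b ^ i.+1 < b.+1 ^ i.+1 /\ b.+1 ^ i <= n * b ^ i.
Proof.
move=> b0 n0; have ex : exists j, n * b ^ j < b.+1 ^ j.
  exists (b * n); rewrite -(ltn_pmul2r b0); apply: leq_trans (bernoulli_expn _ b0).
  have : 0 < b ^ (b * n) by rewrite expn_gt0 b0.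
  by move: (b ^ _) => e e0; nia.
have [[|i] lt min] := ex_minnP ex; first by move: lt; rewrite !expn0; lia.
by exists i; split=> //; rewrite leqNgt; apply/negP => /min; rewrite ltnn.
Qed.

Lemma sqr_le_exp2 i : 9 <= i -> 4 * i.+1 ^ 2 <= 2 ^ i.
Proof.
elim: i => // i IH; rewrite leq_eqVlt => /predU1P [<-|lt]; first by vm_compute.
by have := IH lt; rewrite [2 ^ i.+1]expnS -!mulnn; nia.
Qed.

(* [4 ^ 5 >= 4 * 3 ^ 5]; keeping the power symbolic avoids computing the unary
   number [4 ^ 25]. *)
Lemma exp43_ge q : 4 ^ q * 3 ^ (5 * q) <= 4 ^ (5 * q).
Proof.
by rewrite !expnM -expnMn; case: q => [|q]; rewrite ?expn0 // leq_exp2r.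
Qed.

Lemma sqr_le_exp43 i : 25 <= i -> 81 * i.+1 ^ 2 * 3 ^ i <= 64 * 4 ^ i.
Proof.
elim: i => // i IH; rewrite leq_eqVlt => /predU1P [i25|lt].
  move: {IH} i.+1 i25 => c c25.
  have e1 : 4 ^ 5 * 3 ^ c <= 4 ^ c.
    by have -> : c = 5 * 5 by []; exact: exp43_ge.
  apply: (@leq_trans (64 * (4 ^ 5 * 3 ^ c))); last by rewrite leq_mul2l e1.
  (* At the base this reads [81 * 26 ^ 2 = 54756 <= 65536 = 64 * 4 ^ 5]. *)
  rewrite mulnA leq_mul2r; apply/orP; right.
  by rewrite -c25 -mulnn (_ : 4 ^ 5 = 1024) //; lia.
have := IH lt; rewrite [3 ^ i.+1]expnS [4 ^ i.+1]expnS => h.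
have : 3 * i.+2 ^ 2 <= 4 * i.+1 ^ 2 by rewrite -!mulnn; nia.
move: (3 ^ i) (4 ^ i) h => a b h1 h2.
apply: (@leq_trans (4 * (81 * i.+1 ^ 2 * a))); last by lia.
have : 3 * i.+2 ^ 2 * a <= 4 * i.+1 ^ 2 * a by rewrite leq_mul2r h2 orbT.
lia.
Qed.

(* Lower bound on [n0] obtained from [sqrt (2 * k) >= 2] and from
   [n >= 4 * ck * sqrt n -> sqrt n >= 4 * ck]. *)
Definition order_bound (k : nat) : nat :=
  16 * (k * (k - 1) * (k + 6)) + 2 * k ^ 2 + 4 * k + 4.

Lemma order_bound_sqr k : 2 <= k -> 64 * k ^ 2 <= order_bound k.
Proof. by move=> k2; rewrite /order_bound -mulnn; nia. Qed.

Lemma order_bound_ge3 k : 3 <= k -> 290 * k <= order_bound k.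
Proof. by move=> k2; rewrite /order_bound -mulnn; nia. Qed.

(** Each halving step costs up to three centers. With [n < 3 * d + 3 + 4 * k] for the minimum degree
    [d], the second bound gives [3 * j * k.+1 + k <= d]. *)
Lemma exists_halving_length k n : 2 <= k -> order_bound k <= n ->
  exists2 j, n < 2 ^ j & 9 * k.+1 * j + 7 * k + 2 <= n.
Proof.
move=> k2 kn; have sq := order_bound_sqr k2.
have n0 : 0 < n by lia.
have [i []] := @exists_min_exponent 1 n isT n0.
rewrite !exp1n !muln1 => lt ge; exists i.+1 => //.
have [i9|i9] := leqP 9 i.
  have h1 := leq_trans (sqr_le_exp2 i9) ge.
  have h2 : 15 * (k * i.+1) <= n.
    rewrite -leq_sqr expnMn expnMn.
    apply: leq_trans (_ : (64 * k ^ 2) * (4 * i.+1 ^ 2) <= _); last first.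
      by rewrite -mulnn; apply: leq_mul => //; exact: leq_trans kn.
    by move: (k ^ 2) (i.+1 ^ 2) => a b; nia.
  by nia.
(* Here [i < 9], so at most nine halvings occur; for [k = 2] the margin is [276] against [259]. *)
have [k3|k3] := leqP 3 k; first by have := order_bound_ge3 k3; nia.
have ek : k = 2 by lia.
by move: kn; rewrite ek /order_bound; lia.
Qed.

(** The second bound is three times the degree requirement on centers of degree at least
    [n - 2 - d], with up to [2 * k + 2 * j + 2] centers and [3 * d <= n - 3 - 4 * k]. *)
Lemma exists_quarter_length k n : 2 <= k -> order_bound k <= n ->
  exists2 j, n * 3 ^ j < 4 ^ j & 3 * k.+1 * (2 * k + 2 * j + 1) + 3 <= 2 * n + k.
Proof.
move=> k2 kn; have sq := order_bound_sqr k2.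
have n0 : 0 < n by lia.
have [i [lt ge]] := @exists_min_exponent 3 n isT n0; exists i.+1 => //.
have [i25|i25] := leqP 25 i.
  have h1 : 81 * i.+1 ^ 2 <= 64 * n.
    have p3 : 0 < 3 ^ i by rewrite expn_gt0.
    rewrite -(leq_pmul2r p3); apply: leq_trans (sqr_le_exp43 i25) _.
    by rewrite -mulnA leq_mul2l ge orbT.
  have h2 : 9 * (k * i.+1) <= n.
    rewrite -leq_sqr expnMn expnMn.
    have : k ^ 2 * (81 * i.+1 ^ 2) <= k ^ 2 * (64 * n) by rewrite leq_mul2l h1 orbT.
    have : 64 * k ^ 2 * n <= n * n by rewrite leq_mul2r (leq_trans sq kn) orbT.
    by rewrite -[n ^ 2]mulnn; move: (k ^ 2) (i.+1 ^ 2) => a b; nia.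
  by move: sq; rewrite -mulnn; nia.
have [k3|k3] := leqP 3 k.
  by have := order_bound_ge3 k3; move: sq; rewrite -mulnn; nia.
have ek : k = 2 by lia.
by move: kn; rewrite ek /order_bound; lia.
Qed.

(** * Spanning trees from connected dominating sets *)

Lemma exists_subset_card (T : finType) (A : {set T}) (m : nat) :
  m <= #|A| -> exists2 B : {set T}, B \subset A & #|B| = m.
Proof.
move=> leA; exists [set x in take m (enum A)].
  by apply/subsetP => x; rewrite inE => /mem_take; rewrite mem_enum.
rewrite cardsE; have /card_uniqP -> := take_uniq m (enum_uniq (mem A)).
by rewrite size_takel // -cardE.
Qed.

Lemma card_exists_choice (T : finType) (A B : {set T}) (r : rel T) :
  {in A, forall v, exists2 a, a \in B & r v a} ->
  exists S : {set T}, [/\ S \subset B, #|S| <= #|A|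
    & {in A, forall v, exists2 a, a \in S & r v a}].
Proof.
move=> h; pose g v := odflt v [pick a in B | r v a].
have gP v : v \in A -> (g v \in B) && r v (g v).
  move=> /h [a aB rva]; rewrite /g; case: pickP => [b //|/(_ a)].
  by rewrite aB rva.
exists (g @: A); split; last 1 first.
- move=> v vA; exists (g v); first exact: imset_f.
  by case/andP: (gP v vA).
- by apply/subsetP => _ /imsetP [v vA ->]; case/andP: (gP v vA).
- exact: leq_imset_card.
Qed.

Section SpanningTrees.

Variable G : sgraph.
Implicit Types (u v x c : G) (C S X : {set G}).

Lemma adjC u v : adj u v = adj v u.
Proof. exact: adj_sym. Qed.

Lemma adjxx u : adj u u = false.
Proof. exact: adj_irrefl. Qed.

Section ParentTree.

Variables (x : G) (par : G -> G) (h : G -> nat).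
Hypothesis par_adj : forall v, v != x -> adj v (par v).
Hypothesis par_lt : forall v, v != x -> h (par v) < h v.

Definition parent_rel : rel G :=
  [rel u v | (u != x) && (par u == v) || (v != x) && (par v == u)].

Lemma parent_rel_sym : symmetric parent_rel.
Proof. by move=> u v; rewrite /parent_rel /= orbC. Qed.

Lemma parent_rel_irr : irreflexive parent_rel.
Proof.
move=> u; rewrite /parent_rel /= orbb; apply/negP => /andP [ux /eqP e].
by have := par_adj ux; rewrite e adjxx.
Qed.

Lemma parent_rel_sub : subrel parent_rel (@adj G).
Proof.
move=> u v; rewrite /parent_rel => /= /orP [] /andP [ne /eqP <-]; first exact: par_adj.
by rewrite adjC; exact: par_adj.
Qed.

(** Parents lower [h], so every vertex reaches [x]. On a cycle, both cycle neighbours of a vertex of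
    maximal [h] would be its parent, yet they are distinct. *)
Lemma parent_rel_tree : is_tree (SGraph parent_rel_sym parent_rel_irr).
Proof.
split.
  have toroot v : connect parent_rel v x.
    move: {2}(h v).+1 (ltnSn (h v)) => m; elim: m v => // m IH v lt.
    have [->|vx] := eqVneq v x; first exact: connect0.
    apply: (connect_trans (y := par v)); last first.
      by apply: IH; apply: leq_trans (par_lt vx) _; rewrite -ltnS.
    by apply: connect1; rewrite /parent_rel /= vx eqxx.
  move=> u v; apply: (connect_trans (toroot u)).
  by rewrite (sym_connect_sym parent_rel_sym); exact: toroot.
move=> c sz uc; apply/negP => cyc.
have [v0 v0c] : exists v0, v0 \in c.
  by case: c sz {uc cyc} => // v0 c _; exists v0; rewrite mem_head.
pose v := [arg max_(v > v0 in c) h v].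
have [vc vmax] : v \in c /\ forall w, w \in c -> h w <= h v.
  by rewrite /v; case: arg_maxnP.
have [i s def_c] := rot_to vc.
have mem_s w : w \in v :: s -> h w <= h v.
  by rewrite -def_c mem_rot; exact: vmax.
have nb w : w \in v :: s -> parent_rel v w -> w = par v.
  move=> ws; rewrite /parent_rel => /= /orP [/andP [_ /eqP <-] //|/andP [wx /eqP e]].
  by have := par_lt wx; rewrite e ltnNge mem_s.
move: cyc uc sz; rewrite -(rot_cycle i) -(rot_uniq i) -(size_rot i) def_c.
case: s mem_s nb {def_c} => [//|a [//|b s]] mem_s nb /=.
rewrite rcons_path => /andP [pva /andP [_ /andP [_ plast]]].
have e1 : a = par v by apply: nb => //; rewrite !inE eqxx orbT.
have : last b s = par v.
  by apply: nb; [rewrite 2!inE mem_last !orbT | rewrite parent_rel_sym].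
rewrite -e1 => e2; rewrite inE => /andP [_ /andP [/negP + _]].
by case; rewrite -e2 mem_last.
Qed.

End ParentTree.

Definition induced (C : {set G}) : rel G :=
  [rel u v | [&& u \in C, v \in C & adj u v]].

(** The rank [h] is the distance from [x] inside [C]; the penultimate vertex of a shortest walk
    shows that a parent of smaller rank exists. *)
Lemma connected_parent C x :
  {in C, forall c, connect (induced C) x c} ->
  exists (par : G -> G) (h : G -> nat),
    {in C, forall c, c != x ->
      [/\ par c \in C, adj c (par c) & h (par c) < h c]}.
Proof.
move=> conn.
pose P c n := [exists p : n.-tuple G, path (induced C) x p && (last x p == c)].
(* The guard keeps [h] total: its value is [0] outside [C]. *)
have exP c : exists n, (c \in C) ==> P c n.
  case cC: (c \in C); last by exists 0.
  have /connectP [p pp e] := conn c cC.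
  by exists (size p); apply/existsP; exists (in_tuple p); rewrite pp e eqxx.
pose h c := ex_minn (exP c).
have step c : c \in C -> c != x ->
    exists c', [&& c' \in C, adj c c' & h c' < h c].
  move=> cC cx; rewrite {2}/h; case: ex_minnP => n; rewrite cC /=.
  case/existsP => -[p /= sz] /andP [pp /eqP lp] _.
  case/lastP: p sz pp lp => [|p c1] sz pp lp.
    by rewrite /= in lp; rewrite lp eqxx in cx.
  rewrite last_rcons in lp; subst c1.
  move: pp; rewrite rcons_path => /andP [pp /and3P [l1 l2 l3]].
  exists (last x p); rewrite l1 adjC l3 /= /h.
  case: ex_minnP => m _ /(_ (size p)) le_m.
  rewrite -(eqP sz) size_rcons ltnS; apply: le_m.
  by rewrite l1; apply/existsP; exists (in_tuple p); rewrite pp eqxx.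
pose par c := odflt c [pick c' | [&& c' \in C, adj c c' & h c' < h c]].
exists par, h => c cC cx; rewrite /par; case: pickP => [c' /and3P [] //|no].
by have [c'] := step c cC cx; rewrite no.
Qed.

(** Vertices of [f c] hang from [c], all others outside [C] from some adjacent center, so they are
    leaves. A center gets [k] leaves and one further tree neighbour: its parent, or a child if it is
    the root. *)
Lemma has_2k_ST_of_leaf_sets (k : nat) C x (f : G -> {set G}) :
  k.+1 < #|G| -> x \in C ->
  {in C, forall c, connect (induced C) x c} ->
  {in C, forall c, [/\ f c \subset nbhd c, [disjoint f c & C] & k <= #|f c|]} ->
  {in C &, forall c c', c != c' -> [disjoint f c & f c']} ->
  (forall v, v \notin C -> exists2 c, c \in C & adj c v) ->
  has_2k_ST k G.
Proof.
move=> cardG xC conn fP fdisj dom.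
have [par0 [h0 par0P]] := connected_parent conn.
pose att v := if [pick c in C | v \in f c] is Some c then c
  else odflt x [pick c in C | adj c v].
pose par v := if v \in C then par0 v else att v.
pose h v := if v \in C then h0 v else (\max_(c in C) h0 c).+1.
have attP v : v \notin C -> (att v \in C) && adj v (att v).
  move=> vC; rewrite /att; case: pickP => [c /andP [cC vf]|_].
    rewrite cC /=; have [/subsetP /(_ v vf)] := fP c cC.
    by rewrite inE adjC.
  have [c cC cv] := dom v vC; case: pickP => [c' /andP [-> /=]|/(_ c)].
    by rewrite adjC.
  by rewrite cC cv.
have attf c v : c \in C -> v \in f c -> att v = c.
  move=> cC vf; rewrite /att; case: pickP => [c' /andP [c'C vf']|/(_ c)].
    apply/eqP/negPn/negP => ne.
    have := fdisj _ _ c'C cC ne; rewrite -setI_eq0 => /eqP /setP /(_ v).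
    by rewrite !inE vf vf'.
  by rewrite cC vf.
have notC v : v \notin C -> v != x by apply: contraNneq => ->.
have padj v : v != x -> adj v (par v).
  move=> vx; rewrite /par; case: ifPn => vC; first by have [] := par0P v vC vx.
  by have /andP [] := attP v vC.
have plt v : v != x -> h (par v) < h v.
  move=> vx; rewrite /h /par; have [vC|vC] := boolP (v \in C).
    by have [-> _] := par0P v vC vx.
  have /andP [-> _] := attP v vC.
  rewrite ltnS; apply: (@leq_bigmax_cond _ (mem C) h0).
  by have /andP [] := attP v vC.
have parC v : v != x -> par v \in C.
  move=> vx; rewrite /par; case: ifPn => vC; first by have [] := par0P v vC vx.
  by have /andP [] := attP v vC.
exists (parent_rel x par), (parent_rel_sym x par), (parent_rel_irr padj).
split; [exact: parent_rel_sub | exact: parent_rel_tree padj plt |] => v /=.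
set T := SGraph _ _.
case: (boolP (v \in C)) => vC; last first.
  suff : @deg T v <= 1 by lia.
  rewrite /deg -(cards1 (par v)); apply: subset_leq_card.
  apply/subsetP => w; rewrite !inE /= /parent_rel /= => /orP [/andP [_ /eqP <-]|] //.
  by case/andP => wx /eqP e; rewrite -e parC in vC.
suff : k < @deg T v by lia.
have [fsub fC kf] := fP v vC.
have subf : f v \subset @nbhd T v.
  apply/subsetP => w wf; rewrite inE /= /parent_rel /=.
  have wC : w \notin C by move: fC; rewrite disjoints_subset => /subsetP /(_ w wf); rewrite inE.
  have pw : par w = v by rewrite /par (negbTE wC); apply: attf.
  by rewrite pw (notC w wC) eqxx orbT.
have add1 w : w \in C -> parent_rel x par v w -> k < @deg T v.
  move=> wC vw; apply: leq_ltn_trans kf _; apply: proper_card.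
  apply/properP; split=> //; exists w; first by rewrite inE.
  move: fC; rewrite disjoint_sym disjoints_subset => /subsetP /(_ w wC).
  by rewrite inE.
have [vx|vx] := eqVneq v x; last first.
  have [pC _ _] := par0P v vC vx; apply: (add1 (par0 v)) => //.
  by rewrite /parent_rel /= vx /par vC eqxx.
(* With a single center the tree is a star, of degree [#|G| - 1 > k]. *)
case: (pickP [pred c in C | c != x]) => [c0 c0P|no]; last first.
  have Cx : C = [set x].
    apply/setP => c; rewrite inE; apply/idP/eqP => [cC|-> //].
    by have := no c; rewrite /= cC /= => /negbFE /eqP.
  have <- : #|[set~ x]| = @deg T v; last by rewrite cardsC1; lia.
  apply: eq_card => w; rewrite !inE /= /parent_rel /= vx eqxx /=.
  by case wx: (w == x) => //=; have := parC w; rewrite wx Cx inE => ->.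
(* A non-root center of minimal rank can only have the root as parent, which gives [x] its extra
   neighbour. *)
pose c := [arg min_(c < c0 | (c \in C) && (c != x)) h0 c].
have [/andP [cC cx] cmin] : (c \in C) && (c != x) /\
    forall c', (c' \in C) && (c' != x) -> h0 c <= h0 c'.
  by rewrite /c; case: arg_minnP.
have [pC pa plt0] := par0P c cC cx.
apply: (add1 c) => //; rewrite /parent_rel /= cx vx /par cC /=.
have [_|px] := eqVneq (par0 c) x; first by rewrite ?orbT.
by have := cmin (par0 c); rewrite pC px leqNgt plt0 => /(_ isT).
Qed.

End SpanningTrees.

(** * Choosing centers: disjoint leaves, domination, connectivity *)

Section Centers.

Variable G : sgraph.
Implicit Types (u v x c : G) (C S X : {set G}).

(** Greedy choice: the [m] leaves just picked join the forbidden set, which costs each later center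
    at most [m] neighbours. *)
Lemma disjoint_leaf_sets (m : nat) (s : seq G) X :
  uniq s -> {in s, forall c, #|nbhd c :&: X| + m * size s <= deg c} ->
  exists f : G -> {set G},
    {in s, forall c, [/\ f c \subset nbhd c, [disjoint f c & X] & #|f c| = m]} /\
    {in s &, forall c c', c != c' -> [disjoint f c & f c']}.
Proof.
elim: s X => [|c s IH] X /=; first by exists (fun=> set0).
case/andP => cs us hdeg.
have [|B subB cardB] := @exists_subset_card _ (nbhd c :\: X) m.
  have := hdeg c (mem_head _ _); have := cardsID X (nbhd c).
  by rewrite /deg mulnS; lia.
have [|f [f1 f2]] := IH (X :|: B) us.
  move=> c' c's; have := hdeg c'; rewrite inE c's orbT => /(_ isT).
  rewrite setIUr; have := (leq_card_setU (nbhd c' :&: X) (nbhd c' :&: B)).1.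
  have := subset_leq_card (subsetIr (nbhd c') B); rewrite cardB mulnS; lia.
have [Bc BX] : B \subset nbhd c /\ [disjoint B & X].
  by move: subB; rewrite subsetD => /andP.
have Bf c' : c' \in s -> [disjoint f c' & B].
  move=> c's; have [_ + _] := f1 c' c's.
  by rewrite -!setI_eq0 setIUr setU_eq0 => /andP [].
have neq c' : c' \in s -> (c' == c) = false.
  by move=> c's; apply: contraNF cs => /eqP <-.
exists (fun c' => if c' == c then B else f c'); split.
  move=> c'; rewrite inE; case: eqVneq => [-> _ //|_ /= c's].
  have [? + ?] := f1 c' c's; rewrite -!setI_eq0 setIUr setU_eq0 => /andP [? _].
  by split.
move=> c1 c2; rewrite !inE; case: (eqVneq c1 c) => [->|_] /=.
  by case: (eqVneq c2 c) => [->|_] //= _ c2s _; rewrite disjoint_sym Bf.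
by case: (eqVneq c2 c) => [_ c1s _ _|_ c1s c2s]; [exact: Bf | exact: f2].
Qed.

(* The center [p] gets the prescribed leaves [F], so its degree may be as small
   as [k + 1]. *)
Lemma has_2k_ST_of_centers (k : nat) C x p (F : {set G}) :
  k.+1 < #|G| -> x \in C ->
  {in C, forall c, connect (induced C) x c} ->
  p \in C -> F \subset nbhd p -> [disjoint F & C] -> k <= #|F| ->
  {in C, forall c, c != p -> #|C|.-1 + #|F| + k * #|C|.-1 <= deg c} ->
  (forall v, v \notin C -> exists2 c, c \in C & adj c v) ->
  has_2k_ST k G.
Proof.
move=> cardG xC conn pC Fp FC kF degC dom.
have cardCp c : c \in C -> #|C :\ c| = #|C|.-1.
  by move=> cC; rewrite (cardsD1 c C) cC.
have [|f [f1 f2]] := @disjoint_leaf_sets k (enum (C :\ p)) (C :|: F) (enum_uniq _).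
  move=> c; rewrite mem_enum !inE => /andP [cp cC].
  apply: leq_trans (degC c cC cp); rewrite -cardE (cardCp p pC) leq_add2r.
  rewrite -(cardCp c cC); apply: leq_trans (leq_card_setU (C :\ c) F).
  apply: subset_leq_card; apply/subsetP => w; rewrite !inE => /andP [cw].
  by case: eqVneq cw => [->|] //=; rewrite adjxx.
have Fd c : c \in C -> c != p -> [disjoint f c & F].
  move=> cC cp; have [|_ + _] := f1 c; first by rewrite mem_enum !inE cp.
  by rewrite -!setI_eq0 setIUr setU_eq0 => /andP [].
apply: (@has_2k_ST_of_leaf_sets G k C x (fun c => if c == p then F else f c)) => //.
  move=> c cC; case: (eqVneq c p) => [-> //|cp].
  have [|? + ?] := f1 c; first by rewrite mem_enum !inE cp.
  by rewrite -!setI_eq0 setIUr setU_eq0 => /andP [? _]; split=> //; lia.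
move=> c1 c2 c1C c2C; case: (eqVneq c1 p) => [->|n1].
  by case: (eqVneq c2 p) => [//|n2 _]; rewrite disjoint_sym Fd.
case: (eqVneq c2 p) => [_ _|n2 ne]; first exact: Fd.
by apply: f2 => //; rewrite mem_enum !inE ?n1 ?n2.
Qed.

Definition cnbhd (v : G) : {set G} := v |: nbhd v.

Lemma cnbhdC u v : (u \in cnbhd v) = (v \in cnbhd u).
Proof. by rewrite !inE eq_sym adjC. Qed.

Lemma card_cnbhd v : #|cnbhd v| = (deg v).+1.
Proof. by rewrite cardsU1 inE adjxx. Qed.

(** Double counting yields [y] in [W] whose closed neighbourhood contains at least [#|U| / b]
    vertices of [U]. Each choice leaves at most the fraction [(b - 1) / b], so less than one vertex
    remains after [j] choices. *)
Lemma log_domination (b j : nat) (W U : {set G}) :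
  0 < b -> 0 < #|W| ->
  {in U, forall v, #|W| <= b * #|cnbhd v :&: W|} ->
  #|U| * b.-1 ^ j < b ^ j ->
  exists D : {set G}, [/\ D \subset W, #|D| <= j
    & {in U, forall v, exists2 d, d \in D & v \in cnbhd d}].
Proof.
move=> b0 W0; elim: j U => [|j IH] U hU lt.
  exists set0; rewrite sub0set cards0; split=> // v.
  by move: lt; rewrite !expn0 muln1 ltnS leqn0 cards_eq0 => /eqP ->; rewrite inE.
have cardI (A B : {set G}) : #|A :&: B| = \sum_(v in B) (v \in A).
  rewrite -sum1_card (eq_bigl (fun v => (v \in B) && (v \in A))).
    by rewrite big_mkcondr /=; apply: eq_bigr => v _; case: (v \in A).
  by move=> v; rewrite inE andbC.
have [y yW hy] : exists2 y, y \in W & #|U| <= b * #|cnbhd y :&: U|.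
  have [/exists_inP //|] := boolP [exists y in W, #|U| <= b * #|cnbhd y :&: U|].
  rewrite negb_exists_in => /forall_inP no; exfalso.
  have : \sum_(y in W) b * #|cnbhd y :&: U| < \sum_(y in W) #|U|.
    have [y0 y0W] := card_gt0P W0.
    rewrite (bigD1 y0) //= [X in _ < X](bigD1 y0) //= -addSn; apply: leq_add.
      by rewrite ltnNge no.
    by apply: leq_sum => y /andP [yW _]; rewrite ltnW // ltnNge no.
  have -> : \sum_(y in W) b * #|cnbhd y :&: U| = \sum_(v in U) b * #|cnbhd v :&: W|.
    rewrite -!big_distrr /=; congr (_ * _).
    under eq_bigr do rewrite cardI; rewrite exchange_big /=.
    by apply: eq_bigr => v _; rewrite cardI; apply: eq_bigr => y _; rewrite cnbhdC.
  rewrite sum_nat_const ltnNge => /negP; apply.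
  by rewrite mulnC -sum_nat_const; apply: leq_sum.
have [||D [DW Dj Dd]] := IH (U :\: cnbhd y).
- by move=> v; rewrite inE => /andP [_]; exact: hU.
- rewrite -(ltn_pmul2l b0) -expnS; apply: leq_ltn_trans lt.
  rewrite expnS mulnA [X in _ <= X]mulnA leq_mul2r; apply/orP; right.
  have e := cardsID (cnbhd y) U; rewrite setIC in e.
  by move: hy; rewrite -e -subn1 mulnBr; move: #|_| #|_| b0 => a d; nia.
exists (y |: D); split.
- by rewrite subUset sub1set yW.
- by rewrite cardsU1; lia.
- move=> v vU; case yv: (v \in cnbhd y); first by exists y => //; rewrite setU11.
  have [|d dD dv] := Dd v; first by rewrite inE yv.
  by exists d => //; rewrite setU1r.
Qed.

Lemma induced_subset C S x c :
  C \subset S -> connect (induced C) x c -> connect (induced S) x c.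
Proof.
move=> /subsetP CS; apply: connect_sub => a b /and3P [aC bC ab].
by apply: connect1; rewrite /induced /= !CS.
Qed.

Lemma path_induced S x (q : seq G) :
  path adj x q -> x \in S -> {subset q <= S} ->
  {in q, forall c, connect (induced S) x c}.
Proof.
elim: q x => // y q IH x /= /andP [xy pq] xS qS c.
have yS : y \in S by apply: qS; rewrite mem_head.
have c1 : connect (induced S) x y by apply: connect1; rewrite /induced /= xS yS.
rewrite inE => /orP [/eqP -> //|cq]; apply: (connect_trans c1).
by apply: IH => // z zq; apply: qS; rewrite inE zq orbT.
Qed.

Lemma connected_extension (m : nat) x (D S : {set G}) :
  {in D, forall d, exists q : seq G,
    [/\ path adj x q, last x q = d, size q <= m & {subset q <= S}]} ->
  exists C : {set G}, [/\ x \in C, D \subset C, C \subset x |: S,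
    #|C| <= 1 + m * #|D| & {in C, forall c, connect (induced C) x c}].
Proof.
move=> hD; suff [C [xC DC CS cC conn]] : exists C : {set G},
    [/\ x \in C, {subset enum D <= C}, C \subset x |: S,
      #|C| <= 1 + m * size (enum D) & {in C, forall c, connect (induced C) x c}].
  rewrite -cardE in cC; exists C; split=> //.
  by apply/subsetP => d dD; apply: DC; rewrite mem_enum.
have : {in enum D, forall d, exists q : seq G,
    [/\ path adj x q, last x q = d, size q <= m & {subset q <= S}]}.
  by move=> d; rewrite mem_enum; exact: hD.
elim: (enum D) => [|d s IH] hs.
  exists [set x]; rewrite set11 cards1 subsetUl; split=> //.
  by move=> c; rewrite inE => /eqP ->.
have [|C [xC sC CS cC conn]] := IH.
  by move=> d' d's; apply: hs; rewrite inE d's orbT.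
have [q [pq lq sq qS]] := hs d (mem_head _ _).
pose Q := [set z in q].
exists (C :|: Q); split.
- by rewrite inE xC.
- move=> d'; rewrite inE => /orP [/eqP ->|/sC d'C]; last by rewrite inE d'C.
  by have := mem_last x q; rewrite lq !inE => /orP [/eqP ->|->]; rewrite ?xC ?orbT.
- rewrite subUset CS /=; apply/subsetP => z; rewrite inE => /qS zS.
  by rewrite inE zS orbT.
- have := (leq_card_setU C Q).1; have : #|Q| <= size q by rewrite cardsE card_size.
  rewrite /= mulnS; lia.
- move=> c; rewrite in_setU => /orP [/conn|]; first by apply: induced_subset; exact: subsetUl.
  rewrite inE => cq; apply: (path_induced pq) => //; first by rewrite inE xC.
  by move=> z zq; rewrite !inE zq orbT.
Qed.

End Centers.

(** * Graphs with the Ore condition *)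

Lemma connected_boundary (G : sgraph) (S : {set G}) (a b : G) :
  connected G -> a \in S -> b \notin S ->
  exists c d : G, [/\ c \in S, d \notin S & adj c d].
Proof.
move=> conn aS bS; have /connectP [q] := conn a b.
elim: q a aS => [|y q IH] a aS /=; first by move=> _ e; rewrite e aS in bS.
case/andP => ay pq lq; have [yS|yS] := boolP (y \in S); first exact: IH pq lq.
by exists a, y.
Qed.

Lemma exists_notin (T : finType) (S : {set T}) :
  #|S| < #|T| -> exists x, x \notin S.
Proof.
move=> lt; have /card_gt0P [x xS] : 0 < #|~: S| by have := cardsC S; lia.
by exists x; rewrite inE in xS.
Qed.

Section Ore.

Variable G : sgraph.
Hypothesis conn : connected G.
Hypothesis ore : forall u v : G,
  u != v -> ~~ adj u v -> #|G| <= deg u + deg v + 2.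

Definition low (v : G) : bool := 2 * deg v + 2 < #|G|.

Lemma low_adj (u v : G) : low u -> low v -> u != v -> adj u v.
Proof.
rewrite /low => lu lv uv; apply/negPn/negP => nadj.
by have := ore uv nadj; lia.
Qed.

(** If [x] and [d] are nonadjacent without a common neighbour, their closed neighbourhoods are
    disjoint and, by the Ore condition, cover the graph; an edge leaving one enters the other. *)
Lemma short_path (x d : G) :
  exists q : seq G, [/\ path adj x q, last x q = d & size q <= 3].
Proof.
have [->|dx] := eqVneq d x; first by exists [::].
have [xd|xd] := boolP (adj x d); first by exists [:: d]; rewrite /= xd.
case: (pickP (fun c => adj x c && adj c d)) => [c /andP [xc cd]|no].
  by exists [:: c; d]; rewrite /= xc cd.
have disj : cnbhd x :&: cnbhd d = set0.
  apply/setP => c; rewrite !inE; apply/negP => /andP [].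
  case/predU1P => [->|xc]; case/predU1P => [e|dc].
  - by rewrite e eqxx in dx.
  - by rewrite adjC dc in xd.
  - by rewrite -e xc in xd.
  - by have := no c; rewrite xc adjC dc.
have full : cnbhd x :|: cnbhd d = [set: G].
  apply/eqP; rewrite eqEcard subsetT cardsT cardsU disj cards0 !card_cnbhd.
  by have := ore _ xd; rewrite eq_sym => /(_ dx); lia.
have dS : d \notin cnbhd x by rewrite !inE negb_or dx.
have [c [e [cS eS ce]]] := connected_boundary conn (setU11 x (nbhd x)) dS.
have eD : e \in cnbhd d.
  by move: (in_setT e); rewrite -full in_setU (negbTE eS).
have xc : adj x c.
  move: cS; rewrite !inE => /predU1P [cx|//].
  by move: eS; rewrite !inE -cx ce orbT.
move: eD; rewrite !inE => /predU1P [ed|de].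
  by exists [:: c; d]; rewrite /= xc -ed ce.
by exists [:: c; e; d]; rewrite /= xc ce adjC de.
Qed.

(** The vertices that are not [low] have closed neighbourhoods of at least half the graph, so
    [b = 2]. Paths of length at most three to [x] give up to [3 * j] centers besides [x]; the degree
    bound pays for these, the [k] leaves of [x] and [k] leaves for each of the others. *)
Lemma has_2k_ST_min_deg_large (k j : nat) :
  k.+1 < #|G| -> #|G| < 2 ^ j ->
  (forall v : G, 3 * j * k.+1 + k <= deg v) -> has_2k_ST k G.
Proof.
move=> cardG ltj degG.
have [x xP] : exists x, forall v, low v -> v != x -> adj x v.
  case: (pickP low) => [x lx|no].
    by exists x => v lv vx; apply: low_adj; rewrite // eq_sym.
  have /card_gt0P [x _] : 0 < #|G| by lia.
  by exists x => v; rewrite no.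
have [|||D [_ Dj Dd]] := @log_domination G 2 j [set: G] [set v | ~~ low v] isT.
- by rewrite cardsT; lia.
- by move=> v; rewrite inE /low setIT cardsT card_cnbhd; lia.
- by rewrite exp1n muln1; apply: leq_ltn_trans ltj; exact: max_card.
have [|C [xC DC _ cardC connC]] := @connected_extension G 3 x D [set: G].
  by move=> d _; have [q [? ? ?]] := short_path x d; exists q; split=> // z; rewrite inE.
have cardC1 : #|C|.-1 <= 3 * j by lia.
have [|F FS cF] := @exists_subset_card _ (nbhd x :\: C) k.
  have := cardsID C (nbhd x); rewrite -/(deg x).
  have : #|nbhd x :&: C| <= #|C :\ x|.
    apply: subset_leq_card; apply/subsetP => w; rewrite !inE => /andP [xw ->].
    by case: eqVneq xw => // ->; rewrite adjxx.
  have := degG x; have : #|C| = #|C :\ x|.+1 by rewrite (cardsD1 x C) xC.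
  rewrite mulnS; lia.
move: FS; rewrite subsetD => /andP [Fx FC].
apply: (has_2k_ST_of_centers cardG xC connC xC Fx FC); rewrite ?cF //.
  move=> c cC _; apply: leq_trans (degG c).
  have : k * #|C|.-1 <= k * (3 * j) by rewrite leq_mul2l cardC1 orbT.
  by rewrite mulnS [3 * j * k]mulnC; lia.
move=> v vC; have [lv|lv] := boolP (low v).
  by exists x => //; apply: xP => //; apply: contraNneq vC => ->.
have [|d dD] := Dd v; first by rewrite inE.
have dC := subsetP DC d dD.
rewrite !inE => /predU1P [e|dv]; last by exists d.
by rewrite e dC in vC.
Qed.

(** * Small minimum degree: one hub near [u], the other centers far away *)

Section MinDegree.

Variables (k : nat) (u : G).
Hypothesis k0 : 0 < k.
Hypothesis umin : forall v : G, deg u <= deg v.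
Hypothesis usmall : 3 * deg u + 3 + 4 * k <= #|G|.
Hypothesis big_nbr :
  forall v : G, deg v <= k -> exists2 w, adj v w & k < deg w.

Let N := cnbhd u.
Let A := ~: N.

Lemma card_N : #|N| = (deg u).+1.
Proof. exact: card_cnbhd. Qed.

Lemma card_A : #|A| + (deg u).+1 = #|G|.
Proof. by rewrite addnC -card_N cardsC. Qed.

Lemma mem_N : u \in N.
Proof. exact: setU11. Qed.

Lemma far_deg a : a \in A -> #|G| <= deg a + deg u + 2.
Proof.
rewrite !inE negb_or => /andP [au ua]; apply: ore => //.
by rewrite adjC.
Qed.

Lemma low_near v : low v -> v \in N.
Proof.
move=> lv; apply/negPn/negP => vN; have := @far_deg v; rewrite inE => /(_ vN).
by move: lv usmall; rewrite /low; lia.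
Qed.

(* By minimality of [deg u], a closed neighbourhood inside [N] fills it. *)
Lemma near_no_exit v :
  v \in N -> (forall a, a \in A -> ~~ adj v a) -> cnbhd v = N.
Proof.
move=> vN noA; apply/eqP; rewrite eqEcard card_N card_cnbhd ltnS umin andbT.
apply/subsetP => w; rewrite in_setU1 => /predU1P [-> //|]; rewrite inE => vw.
by apply/negPn/negP => wN; have := noA w; rewrite inE wN vw => /(_ isT).
Qed.

Definition exits v := [exists a in A, adj v a].

(** If [k < deg u], any vertex of [N] on an edge leaving [N] will do. Otherwise [big_nbr] gives a
    neighbour of [u] of degree above [k], hence above [deg u]; without an exit its closed
    neighbourhood would be [N], which is too small. *)
Lemma exists_big_exit : exists p, [/\ p \in N, exits p & k < deg p].
Proof.
have [ku|ku] := ltnP k (deg u).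
  have [b bN] : exists b, b \notin N.
    by apply: exists_notin; rewrite card_N; lia.
  have [c [e [cN eN ce]]] := connected_boundary conn mem_N bN.
  exists c; split=> //; last exact: leq_trans (umin c).
  by apply/exists_inP; exists e => //; rewrite in_setC.
have [w uw kw] := big_nbr ku.
have wN : w \in N by rewrite !inE uw orbT.
exists w; split=> //; have [//|] := boolP (exits w).
rewrite /exits negb_exists_in => /forall_inP no.
by have := near_no_exit wN no => /(congr1 (fun S : {set G} => #|S|)); rewrite card_N card_cnbhd; lia.
Qed.

(* The low-degree vertices missed by the hub [p] have degree at most [k]; they
   are at most [k] in number and are attached to [B]. *)
Lemma exists_hub : exists (p : G) (B : {set G}),
  [/\ exits p, B \subset A, #|B| <= k, k + #|B| < deg p
    & forall v, low v -> v != p -> adj p v \/ exists2 b, b \in B & adj v b].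
Proof.
(* A [low] hub is adjacent to all other [low] vertices, so [B] can be empty. *)
case: (pickP (fun p => [&& exits p, low p & k < deg p])) => [p /and3P [ep lp kp]|no].
  exists p, set0; rewrite sub0set cards0 addn0; split=> // v lv vp; left.
  by apply: low_adj; rewrite // eq_sym.
have [p [pN ep kp]] := exists_big_exit.
have hp : ~~ low p by have := no p; rewrite ep kp andbT => /negbT.
pose V0 := [set v in N | low v && exits v].
have V0k v : v \in V0 -> deg v <= k.
  rewrite inE => /and3P [_ lv ev]; have := no v; rewrite ev lv /=.
  by move/negbT; rewrite -leqNgt.
have cV0 : #|V0| <= k.
  have [->|[v vV0]] := set_0Vmem V0; first by rewrite cards0.
  apply: leq_trans (leq_trans (umin v) (V0k v vV0)).
  (* [u] itself has no exit, so [V0] consists of neighbours of [u]. *)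
  apply: subset_leq_card; apply/subsetP => w; rewrite inE => /and3P [].
  rewrite in_setU1 => /predU1P [->|//] _ /exists_inP [a].
  by rewrite !inE negb_or => /andP [_ /negP ua] /ua.
have [|B [BA cB Bd]] := @card_exists_choice _ V0 A (@adj G).
  by move=> v; rewrite inE => /and3P [_ _ /exists_inP].
exists p, B; split=> //; first exact: leq_trans cB cV0.
  by move: hp; rewrite /low -leqNgt; lia.
move=> v lv vp; have vN := low_near lv.
have [ev|] := boolP (exits v); first by right; apply: Bd; rewrite inE vN lv.
(* Without exits, the closed neighbourhood of [v] is all of [N], which contains [p]. *)
rewrite /exits negb_exists_in => /forall_inP noA; left.
move: pN; rewrite -(near_no_exit vN noA) !inE eq_sym (negbTE vp) /=.
by rewrite adjC.
Qed.

(** Vertices of [A] share at least [2 * (n - 2 - d) - n] neighbours, while [N] and [F] together have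
    at most [d + 1 + k] vertices, which is fewer as [n >= 3 * d + 3 + 4 * k]. *)
Lemma far_common_nbr (F : {set G}) x e :
  #|F| = k -> x \in A -> e \in A -> exists c, [&& c \in A :\: F, adj x c & adj c e].
Proof.
move=> cF xA eA; have [/existsP //|] := boolP [exists c, [&& c \in A :\: F, adj x c & adj c e]].
rewrite negb_exists => /forallP no; exfalso.
have sub : nbhd x :&: nbhd e \subset N :|: F.
  apply/subsetP => c; rewrite in_setI => /andP []; rewrite 2!inE => xc ec.
  have := no c; rewrite xc [adj c e]adjC ec !andbT in_setD in_setC in_setU.
  by case: (c \in F); rewrite ?orbT //= negbK => ->.
have := subset_leq_card sub; have := (leq_card_setU N F).1.
have := cardsUI (nbhd x) (nbhd e); have := max_card (nbhd x :|: nbhd e).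
have := far_deg xA; have := far_deg eA; rewrite card_N cF -!/(deg _).
by move: usmall k0; lia.
Qed.

(** The leaves [F] of the hub [p] are fixed first. All other centers lie in [A :\: F]: a neighbour
    [x] of [p], the set [B], a dominating set [D], and the midpoints of paths of length two from
    [x]. *)
Lemma has_2k_ST_min_deg_small (j : nat) :
  #|G| * 3 ^ j < 4 ^ j ->
  3 * k.+1 * (2 * k + 2 * j + 1) + 3 <= 2 * #|G| + k -> has_2k_ST k G.
Proof.
move=> ltj num.
have [p [B [/exists_inP [x xA px] BA cB pdeg lowP]]] := exists_hub.
have [|F FS cF] := @exists_subset_card _ (nbhd p :\: (x |: B)) k.
  have := cardsID (x |: B) (nbhd p).
  have := subset_leq_card (subsetIr (nbhd p) (x |: B)).
  have : #|x |: B| <= 1 + #|B| by rewrite cardsU1 leq_add2r; case: (_ \notin _).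
  by move: pdeg; rewrite /deg; lia.
move: FS; rewrite subsetD => /andP [Fp Fdis].
have xF : x \notin F.
  by apply/negP => xF; move: (disjointFr Fdis xF); rewrite setU11.
have BF b : b \in B -> b \notin F.
  by move=> bB; apply/negP => bF; move: (disjointFr Fdis bF); rewrite setU1r.
pose W := A :\: F.
have cW : #|W| <= #|A| by apply: subset_leq_card; exact: subsetDl.
have cA := card_A.
(* Half the graph minus [N] and [F] leaves [n / 2 - (d + 1 + k)] vertices; four times this is at
   least [#|A| = n - d - 1] exactly when [n >= 3 * d + 3 + 4 * k], whence [b = 4]. *)
have [|||D [DW Dj Dd]] := @log_domination G 4 j W [set v | ~~ low v] isT.
- by have := cardsID F A; have := subset_leq_card (subsetIr A F); rewrite -/W; lia.
- move=> v; rewrite inE /low -leqNgt => hv.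
  have : cnbhd v \subset (cnbhd v :&: W) :|: (N :|: F).
    apply/subsetP => w wv; rewrite in_setU [w \in N :|: F]in_setU in_setI wv.
    by rewrite in_setD in_setC; case: (w \in N); case: (w \in F).
  move/subset_leq_card; have := (leq_card_setU (cnbhd v :&: W) (N :|: F)).1.
  have := (leq_card_setU N F).1; rewrite card_N card_cnbhd cF.
  by move: usmall; lia.
- apply: leq_ltn_trans ltj; rewrite leq_mul2r; apply/orP; right; exact: max_card.
have EW : B :|: D \subset W.
  rewrite subUset DW andbT; apply/subsetP => b bB.
  by rewrite in_setD BF // (subsetP BA).
have cE : #|B :|: D| <= k + j.
  by apply: leq_trans (leq_card_setU B D).1 _; apply: leq_add.
have [|C0 [xC0 EC0 C0W cC0 conn0]] := @connected_extension G 2 x (B :|: D) W.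
  move=> e eE; have eW := subsetP EW e eE.
  have [<-|ex] := eqVneq e x; first by exists [::].
  have [xe|xe] := boolP (adj x e).
    by exists [:: e]; rewrite /= xe; split=> // z; rewrite inE => /eqP ->.
  have eA : e \in A by move: eW; rewrite in_setD => /andP [].
  have [c /and3P [cWm xc ce]] := far_common_nbr cF xA eA.
  exists [:: c; e]; rewrite /= xc ce; split=> // z.
  by rewrite !in_cons orbF => /orP [] /eqP ->.
have C0A c : c \in C0 -> c \in A.
  move=> /(subsetP C0W); rewrite in_setU1 => /predU1P [-> //|].
  by rewrite in_setD => /andP [].
have C0F c : c \in C0 -> c \notin F.
  move=> /(subsetP C0W); rewrite in_setU1 => /predU1P [-> //|].
  by rewrite in_setD => /andP [].
pose C := p |: C0.
have cC : #|C|.-1 <= 2 * k + 2 * j + 1.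
  have : #|C| <= 1 + #|C0| by rewrite cardsU1 leq_add2r; case: (_ \notin _).
  lia.
have xC : x \in C by rewrite setU1r.
have pC : p \in C by rewrite setU11.
have C0C : C0 \subset C by exact: subsetUr.
have connC : {in C, forall c, connect (induced C) x c}.
  move=> c; rewrite in_setU1 => /predU1P [->|cC0'].
    by apply: connect1; rewrite /induced /= xC pC adjC.
  by apply: (induced_subset C0C); exact: conn0.
apply: (has_2k_ST_of_centers _ xC connC pC Fp); rewrite ?cF //.
- by clear -usmall k0; lia.
- rewrite disjoint_sym disjoints_subset; apply/subsetP => c; rewrite in_setU1 in_setC.
  case/predU1P => [->|/C0F //]; apply/negP => /(subsetP Fp).
  by rewrite inE adjxx.
- move=> c; rewrite in_setU1 => /predU1P [-> |/C0A /far_deg cdeg _].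
    by rewrite eqxx.
  (* The requirement amounts to [(#|C| - 1) * (k + 1) + k <= n - 2 - d]. *)
  have : #|C|.-1 * k.+1 <= (2 * k + 2 * j + 1) * k.+1 by rewrite leq_mul2r cC orbT.
  have -> : k * #|C|.-1 = #|C|.-1 * k.+1 - #|C|.-1 by rewrite mulnS mulnC addKn.
  move: num usmall; rewrite -mulnA [k.+1 * _]mulnC.
  have : #|C|.-1 <= #|C|.-1 * k.+1 by rewrite leq_pmulr.
  by move: cdeg; clear; move: (#|C|.-1) (_ * k.+1) (_ * k.+1) => m a b; lia.
move=> v vC; have vp : v != p by apply: contraNneq vC => ->.
have [lv|lv] := boolP (low v).
  have [pv|[b bB vb]] := lowP v lv vp; first by exists p.
  exists b; last by rewrite adjC.
  by apply: (subsetP C0C); apply: (subsetP EC0); rewrite inE bB.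
have [|d dD] := Dd v; first by rewrite inE.
have dC : d \in C by apply: (subsetP C0C); apply: (subsetP EC0); rewrite inE dD orbT.
rewrite !inE => /predU1P [e|dv]; last by exists d.
by rewrite e dC in vC.
Qed.

End MinDegree.

End Ore.

(** * The exceptional family *)

Definition stuck (k : nat) (G : sgraph) : Prop :=
  exists2 u : G, deg u <= k & forall v, adj u v -> deg v <= k.

(** The closed tree neighbourhood of [u] has at most two vertices, so a tree edge leaves it and
    gives a leaf a second neighbour. *)
Lemma stuck_no_2k_ST k (G : sgraph) :
  2 < #|G| -> has_2k_ST k G -> ~ stuck k G.
Proof.
move=> cardG [t [ts [ti [tsub [tconn _] tdeg]]]] [u uk unb].
move: tconn tdeg; set T := SGraph ts ti => tconn tdeg.
have leaf (v : G) : deg v <= k -> @deg T v <= 1.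
  move=> vk; have : @deg T v <= deg v.
    by apply: subset_leq_card; apply/subsetP => w; rewrite !inE; exact: tsub.
  by have := tdeg v; rewrite negb_and -!ltnNge; lia.
have [b bS] : exists b, b \notin @cnbhd T u.
  apply: exists_notin; rewrite card_cnbhd.
  by apply: leq_ltn_trans cardG; rewrite ltnS; exact: leaf.
have [c [d [cS dS cd]]] := connected_boundary tconn (setU11 u _ : u \in @cnbhd T u) bS.
move: cS; rewrite !inE => /predU1P [cu|uc].
  by move: dS; rewrite !inE -cu cd orbT.
have := leaf c (unb c (tsub _ _ uc)); rewrite leqNgt => /negP; apply.
rewrite /deg (cardsD1 u) inE adjC uc ltnS card_gt0; apply/set0Pn; exists d.
by move: dS; rewrite !inE negb_or cd => /andP [->].
Qed.

Lemma stuck_iso k (G H : sgraph) : isomorphic G H -> stuck k H -> stuck k G.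
Proof.
case=> f [g fK gK] fadj [u uk unb].
have degf v : deg (f v) = deg v.
  rewrite /deg -(card_imset _ (can_inj fK)); apply: eq_card => w.
  by rewrite inE -[w]gK fadj mem_imset ?inE //; exact: can_inj fK.
exists (g u) => [|v gv]; first by rewrite -degf gK.
by rewrite -degf; apply: unb; rewrite -[u]gK fadj.
Qed.

(** A vertex of [L2] has degree at most [k] and sees the rest of the clique [L1 :|: L2], so this
    clique has at most [k + 1] vertices; all neighbours of [L1] lie in it. *)
Lemma Gkn_stuck k n (H : sgraph) : Gkn k n H -> stuck k H.
Proof.
case=> _ [L1 [L2 [L3 [L4 [[full _ nonempty] [cl _] hL1 hL2 _]]]]].
case/and4P: nonempty => /set0Pn [u uL1] /set0Pn [w wL2] _ _.
have nb1 v y : v \in L1 -> adj v y -> y \in L1 :|: L2.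
  move=> vL1 vy; move: (in_setT y); rewrite -full.
  rewrite -setUA in_setU => /orP [//|yL].
  by have := hL1 v vL1 y yL; rewrite vy.
have small v : v \in L1 :|: L2 -> deg v <= k.
  rewrite inE => /orP [vL1|vL2]; last by have [] := hL2 v vL2.
  have [_ _ wk] := hL2 w wL2; apply: leq_trans wk.
  have vL : v \in L1 :|: L2 by rewrite inE vL1.
  have wL : w \in L1 :|: L2 by rewrite inE wL2 orbT.
  apply: (@leq_trans #|(L1 :|: L2) :\ v|).
    apply: subset_leq_card; apply/subsetP => y; rewrite inE in_setD1 => vy.
    rewrite (nb1 v) // andbT; apply: contraTneq vy => ->.
    by rewrite adjxx.
  have := cardsD1 v (L1 :|: L2); rewrite (cardsD1 w (L1 :|: L2)) vL wL !add1n => -[<-].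
  apply: subset_leq_card; apply/subsetP => y; rewrite in_setD1 => /andP [yw yL].
  by rewrite inE; apply: cl => //; rewrite eq_sym.
exists u => [|v uv]; apply: small; first by rewrite inE uL1.
exact: nb1 uv.
Qed.

(** The set [Q] of vertices of degree at most [k] is a clique by the Ore condition, and equals the
    closed neighbourhood of [u]. Both [Q] and its complement are split by whether a vertex has a
    neighbour on the other side. *)
Lemma stuck_Gkn k (G : sgraph) :
  connected G ->
  (forall u v : G, u != v -> ~~ adj u v -> #|G| <= deg u + deg v + 2) ->
  2 * k + 2 < #|G| -> k.+1 ^ 2 < #|G| -> stuck k G -> Gkn k #|G| G.
Proof.
move=> conn ore big1 big2 [u uk unb]; split=> //.
pose Q := [set v : G | deg v <= k].
pose L1 := [set v in Q | nbhd v \subset Q].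
pose L3 := [set v in ~: Q | [exists q in Q, adj v q]].
have clQ : clique Q.
  move=> v w; rewrite !inE => vk wk vw; apply/negPn/negP => nadj.
  by have := ore v w vw nadj; lia.
have uQ : u \in Q by rewrite inE.
have uL1 : u \in L1.
  by rewrite inE uQ; apply/subsetP => v; rewrite !inE; exact: unb.
have cardQ : #|Q| = (deg u).+1.
  rewrite -card_cnbhd; congr #|pred_of_set _|; apply/setP => v; apply/idP/idP.
    move=> vQ; rewrite !inE; have [//|vu] := eqVneq v u.
    by rewrite clQ // eq_sym.
  by rewrite in_setU1 => /predU1P [-> //|]; rewrite !inE; exact: unb.
have degC v : v \notin Q -> #|G| - #|Q| - 1 <= deg v.
  move=> vQ; have uv : u != v by apply: contraNneq vQ => <-.
  have nadj : ~~ adj u v.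
    by apply: contraNN vQ => uv'; rewrite inE; exact: unb.
  by have := ore u v uv nadj; rewrite cardQ; lia.
(* The degree bound [degC] leaves a vertex without neighbours in [Q] no choice but to see all other
   vertices outside [Q]. *)
have univ v : v \notin Q -> v \notin L3 -> forall w, w \notin Q -> w != v -> adj v w.
  move=> vQ vL3; have noQ q : q \in Q -> ~~ adj v q.
    move=> qQ; apply: contraNN vL3 => vq; rewrite inE in_setC vQ.
    by apply/exists_inP; exists q.
  have sub : nbhd v \subset ~: Q :\ v.
    apply/subsetP => w; rewrite inE in_setD1 in_setC => vw; apply/andP; split.
      by apply: contraTneq vw => ->; rewrite adjxx.
    by apply: contraTN vw => /noQ.
  have eqN : nbhd v = ~: Q :\ v.
    apply/eqP; rewrite eqEcard sub; have := degC v vQ.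
    have := cardsD1 v (~: Q); rewrite in_setC vQ; have := cardsC Q.
    by rewrite /deg /=; lia.
  move=> w wQ wv; have : w \in nbhd v by rewrite eqN in_setD1 wv in_setC.
  by rewrite inE.
have [b bQ] : exists b, b \notin Q by apply: exists_notin; rewrite cardQ; lia.
(* This edge witnesses that [L2] and [L3] are non-empty. *)
have [c [d [cQ dQ cd]]] := connected_boundary conn uQ bQ.
(* For [L4] to be non-empty: at most [k + 1] closed neighbourhoods of size at most [k + 1] cover
   [Q :|: L3]. *)
have [y yP] : exists y, y \notin Q :|: L3.
  apply: exists_notin; apply: leq_ltn_trans big2.
  apply: (@leq_trans #|\bigcup_(q in Q) cnbhd q|).
    apply: subset_leq_card; apply/subsetP => w; rewrite in_setU => /orP [wQ|].
      by apply/bigcupP; exists w; rewrite ?setU11.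
    rewrite inE => /andP [_ /exists_inP [q qQ wq]].
    by apply/bigcupP; exists q; rewrite // !inE adjC wq orbT.
  apply: leq_trans (_ : \sum_(q in Q) k.+1 <= _); last first.
    by rewrite sum_nat_const cardQ -mulnn leq_mul2r ltnS uk orbT.
  elim/big_rec2: _ => [|q m S qQ le]; first by rewrite cards0.
  apply: leq_trans (leq_card_setU _ _).1 _; apply: leq_add => //.
  by rewrite card_cnbhd ltnS; rewrite inE in qQ.
have L1Q : L1 \subset Q by apply/subsetP => v; rewrite inE => /andP [].
have L12 : L1 :|: (Q :\: L1) = Q.
  apply/setP => v; rewrite in_setU in_setD.
  by have [/(subsetP L1Q) ->|] := boolP (v \in L1).
have L3Q v : v \in L3 -> v \notin Q by rewrite inE in_setC => /andP [].
exists L1, (Q :\: L1), L3, (~: (Q :|: L3)); rewrite L12; split.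
- split.
  + by rewrite setUCr.
  + have dQ3 : [disjoint Q & L3].
      by rewrite disjoint_sym disjoints_subset; apply/subsetP => v /L3Q; rewrite in_setC.
    have d1 : [disjoint L1 & L3] by apply: disjointWl dQ3.
    have d2 : [disjoint Q :\: L1 & L3] by apply: disjointWl dQ3; exact: subsetDl.
    have dd (S : {set G}) : S \subset Q :|: L3 -> [disjoint S & ~: (Q :|: L3)].
      by rewrite disjoints_subset setCK.
    have d0 : [disjoint L1 & Q :\: L1].
      rewrite disjoint_sym disjoints_subset; apply/subsetP => v.
      by rewrite in_setD in_setC => /andP [].
    have QL3 := subsetUl Q L3; have L12Q := subset_trans (subsetDl Q L1) QL3.
    by rewrite d0 d1 d2 !dd ?subsetUr // (subset_trans L1Q).
  + apply/and4P; split; apply/set0Pn.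
    * by exists u.
    * exists c; rewrite in_setD cQ andbT inE cQ /=; apply/subsetPn; exists d => //.
      by rewrite inE.
    * exists d; rewrite inE in_setC dQ; apply/exists_inP; exists c => //.
      by rewrite adjC.
    * by exists y; rewrite in_setC.
- split=> // v w; rewrite !in_setC !in_setU !negb_or => /andP [v1 v2] /andP [w1 w2] vw.
  by apply: univ; rewrite // eq_sym.
- move=> v; rewrite inE => /andP [vQ /subsetP sub] w; rewrite in_setU => wP.
  apply/negP => vw; have wQ : w \in Q by apply: sub; rewrite inE.
  case/orP: wP => [/L3Q|]; first by rewrite wQ.
  by rewrite in_setC in_setU wQ.
- move=> v; rewrite in_setD => /andP [vL1 vQ].
  split; last by rewrite inE in vQ.
    have : ~~ (nbhd v \subset Q) by apply: contraNN vL1 => sub; rewrite inE vQ.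
    case/subsetPn => w; rewrite inE => vw wQ; exists w => //.
    by rewrite inE in_setC wQ; apply/exists_inP; exists v; rewrite // adjC.
  move=> w; rewrite in_setC in_setU negb_or => /andP [wQ wL3].
  apply: contraNN wL3 => vw; rewrite inE in_setC wQ.
  by apply/exists_inP; exists v; rewrite // adjC.
- move=> v vL3; have vQ := L3Q v vL3; split; last exact: degC.
    move: (vL3); rewrite inE => /andP [_ /exists_inP [q qQ vq]]; exists q => //.
    rewrite in_setD qQ andbT inE qQ /=; apply/subsetPn; exists v => //.
    by rewrite inE adjC.
  move=> w; rewrite in_setC in_setU negb_or => /andP [wQ wL3].
  rewrite adjC; apply: univ => //; apply: contraNneq wL3 => <-.
  exact: vL3.
Qed.

(** * Unpacking the hypotheses and the final case split *)

Lemma ore_of_sigma2 (G : sgraph) (n : nat) :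
  ((n%:Z - 2)%R%:E <= sigma2 G)%E ->
  forall u v : G, u != v -> ~~ adj u v -> n <= deg u + deg v + 2.
Proof.
move=> hs u v uv nadj.
have : ((n%:Z - 2)%R%:E <= ((deg u + deg v)%N%:Z)%:E)%E.
  apply: le_trans hs _; rewrite /sigma2 (bigD1 (u, v)) /=; last by rewrite uv.
  by rewrite ge_min lexx.
by rewrite lee_fin; lia.
Qed.

Lemma order_bound_le_n0 (R : realType) (k n0 n : nat) :
  2 <= k -> is_n0 R k n0 -> n0 <= n -> order_bound k <= n.
Proof.
move=> k2 [_ bd _] /bd; rewrite /ck.
have k2R : (2 <= k%:R :> R)%R by rewrite (ler_nat R 2).
set r := Num.sqrt (2 * k%:R)%R.
have r2 : (2 <= r)%R.
  have -> : (2 = Num.sqrt (2 ^+ 2) :> R)%R by rewrite sqrtr_sqr ger0_norm.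
  by apply: ler_wsqrtr; lra.
set M := (k%:R * (k%:R - 1) * (k%:R + 2 * r + 2))%R.
have M0 : (k%:R * (k%:R - 1) * (k%:R + 6) <= M)%R.
  by apply: ler_wpM2l; [apply: mulr_ge0; lra | lra].
have M0' : (0 <= M)%R.
  by apply: le_trans M0; apply: mulr_ge0; [apply: mulr_ge0; lra | lra].
have := sqr_sqrtr M0'; have := sqrtr_ge0 M; set c := Num.sqrt M => c0 c2.
have := sqr_sqrtr (ler0n R n); have := sqrtr_ge0 (n%:R : R)%R.
set s := Num.sqrt n%:R => s0 s2 h.
have kk : (0 <= k%:R ^+ 2 :> R)%R by exact: sqr_ge0.
(* Otherwise [s ^ 2 - 4 * c * s <= 0], and the remaining terms of [h] are negative. *)
have s4 : (4 * c <= s)%R.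
  rewrite leNgt; apply/negP => lt.
  have : (s * s <= 4 * c * s)%R by apply: ler_wpM2r => //; exact: ltW.
  by move: h; rewrite -s2 expr2; lra.
have h1 : (4 * c * (4 * c) <= 4 * c * s)%R by apply: ler_wpM2l => //; lra.
have h2 : (16 * (k%:R * (k%:R - 1) * (k%:R + 6)) + 2 * k%:R ^+ 2 + 4 * k%:R + 4
            <= n%:R :> R)%R.
  move: h1; rewrite (_ : (4 * c * (4 * c) = 16 * c ^+ 2)%R); last by rewrite expr2; lra.
  by rewrite c2; lra.
rewrite -(ler_nat R) /order_bound !natrD -mulnn !natrM natrD natrB; last exact: ltnW.
by move: h2; rewrite expr2; lra.
Qed.

Theorem theorem1p1 (R : realType) (k n n0 : nat) (G : sgraph)
  (hk : (2 <= k)%N)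
  (hn0 : is_n0 R k n0)
  (hord : #|G| = n)
  (hn : (n0 <= n)%N)
  (hconn : connected G)
  (hsigma : ((n%:Z - 2)%R%:E <= sigma2 G)%E) :
  has_2k_ST k G <-> ~ (exists2 H : sgraph, Gkn k n H & isomorphic G H).
Proof.
have bd := order_bound_le_n0 hk hn0 hn.
have sq := order_bound_sqr hk.
have ore := ore_of_sigma2 hsigma; rewrite -hord in ore bd *.
have n64 : 64 * k * k <= #|G| by rewrite -mulnA mulnn; lia.
have n2 : 2 * k + 2 < #|G| by clear -hk n64; nia.
have nsq : k.+1 ^ 2 < #|G| by rewrite -mulnn; clear -hk n64; nia.
split=> [st [H /Gkn_stuck stH isoGH]|noH].
  by apply: stuck_no_2k_ST st (stuck_iso isoGH stH); clear -hk n2; lia.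
have big_nbr (v : G) : deg v <= k -> exists2 w, adj v w & k < deg w.
  move=> vk; apply/exists_inP; apply: contraT => /exists_inPn no.
  case: noH; exists G; last by exists id => //; exists id.
  apply: stuck_Gkn => //; exists v => // w vw; rewrite leqNgt; exact: no.
have /card_gt0P [u0 _] : 0 < #|G| by clear -n2; lia.
pose u := [arg min_(v < u0) deg v].
have umin (v : G) : deg u <= deg v by rewrite /u; case: arg_minnP => // i _; exact.
have [small|large] := leqP (3 * deg u + 3 + 4 * k) #|G|.
  have [j ltj num] := exists_quarter_length hk bd.
  apply: (@has_2k_ST_min_deg_small G hconn ore k u) ltj num => //.
  exact: ltnW.
have [j ltj num] := exists_halving_length hk bd.
apply: (has_2k_ST_min_deg_large hconn ore _ ltj); first by clear -n2; lia.
move=> v; apply: leq_trans (umin v); clear -large num; lia.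
Qed.
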